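(* Let $\mathcal O^K=\mathcal O_1\times\dots\times\mathcal O_K$ be the direct product of observation schemes $\mathcal O_k$, each of which is Gaussian, Discrete or scalar Poisson, with parameter sets $\mathcal M_k$ (see context). Let $X_k,Y_k$ be nonempty compact convex subsets of $\mathcal M_k$, $k=1,\dots,K$, and let $X=X_1\times\dots\times X_K$, $Y=Y_1\times\dots\times Y_K$. Let $[x_*;y_*]$, with $x_*=([x_*]_1,\dots,[x_*]_K)$, $y_*=([y_*]_1,\dots,[y_*]_K)$, be an optimal solution to the convex optimization problem $$\mathrm{Opt}=\max_{x\in X,\,y\in Y}\ \sum_{k=1}^K\psi_k(x_k,y_k),$$ where the functions $\psi_k$ are defined in the context, and let $\varepsilon_\star=\exp\{\mathrm{Opt}/2\}$. Then for every $a\in\mathbb R$ the error probabilities of the simple test with detector $\phi_*^a(\omega^K)=\sum_{k=1}^K\phi_*^k(\omega_k)-a$, with $\phi_*^k$ defined in the context, satisfy $$\epsilon_X\le e^{a}\varepsilon_\star\quad\text{and}\quad \epsilon_Y\le e^{-a}\varepsilon_\star.$$ Besides this, no test can distinguish between the hypotheses $H_X$ and $H_Y$ with risk less than $\varepsilon_\star^2/4$.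
   Context: One observes $\omega^K=(\omega_1,\dots,\omega_K)$, where $\omega_k$ are drawn independently of each other, the distribution of $\omega_k$ being specified by a parameter $\mu_k\in\mathcal M_k$; $\mu^K=(\mu_1,\dots,\mu_K)\in\mathcal M_1\times\dots\times\mathcal M_K$ is unknown. Hypothesis $H_X$ states that $\mu^K\in X$, $H_Y$ that $\mu^K\in Y$. The factors are of the following types, and the associated functions $\psi_k$ and detectors $\phi^k_*$ are as follows. - Gaussian: $\omega_k\in\mathbb R^{m_k}$, $\omega_k\sim\mathcal N(\mu_k,\Sigma_k)$ with known nondegenerate covariance matrix $\Sigma_k$, $\mathcal M_k=\mathbb R^{m_k}$; $\psi_k(\mu,\nu)=-\frac14(\mu-\nu)^T\Sigma_k^{-1}(\mu-\nu)$; $\phi_*^k(\omega_k)=\xi_k^T\omega_k-\alpha_k$ with $\xi_k=\frac12\Sigma_k^{-1}\big[[x_*]_k-[y_*]_k\big]$, $\alpha_k=\frac12\xi_k^T\big[[x_*]_k+[y_*]_k\big]$. - Scalar Poisson: $\omega_k\in\mathbb Z_+$ is Poisson with parameter $\mu_k\in\mathcal M_k=(0,\infty)$; $\psi_k(\mu,\nu)=-(\sqrt\mu-\sqrt\nu)^2$; $\phi_*^k(\omega_k)=\frac12\omega_k\ln\big([x_*]_k/[y_*]_k\big)-\frac12\big([x_*]_k-[y_*]_k\big)$. - Discrete: $\omega_k\in\{1,\dots,m_k\}$ takes value $i$ with probability $[\mu_k]_i$, $\mathcal M_k=\{\mu\in\mathbb R^{m_k}:\mu>0,\sum_i\mu_i=1\}$;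 $\psi_k(\mu,\nu)=2\ln\big(\sum_{i=1}^{m_k}\sqrt{\mu_i\nu_i}\big)$; $\phi_*^k(\omega_k)=\frac12\ln\big([[x_*]_k]_{\omega_k}/[[y_*]_k]_{\omega_k}\big)$. A test is a Borel function of $\omega^K$ accepting exactly one of $H_X,H_Y$ and rejecting the other. Its error probabilities are $\epsilon_X$, the supremum over $\mu^K\in X$ of the probability to reject $H_X$, and $\epsilon_Y$, the supremum over $\mu^K\in Y$ of the probability to reject $H_Y$; the risk is $\max\{\epsilon_X,\epsilon_Y\}$. The simple test with detector $\phi$ accepts $H_X$ when $\phi(\omega^K)\ge0$ and accepts $H_Y$ otherwise. *)

(* Defs.v *)
From HB Require Import structures.
From mathcomp Require Import all_boot all_order all_algebra.
From mathcomp Require Import all_classical all_reals all_analysis.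
From mathcomp Require Import ring lra.

Set Implicit Arguments.
Unset Strict Implicit.
Unset Printing Implicit Defensive.

Import Order.TTheory GRing.Theory Num.Theory.
Import numFieldNormedType.Exports.

Local Open Scope classical_set_scope.
Local Open Scope ring_scope.

(* Finite products of possibly different measurable spaces: dependent families
   w, with w i in T i, under the sigma-algebra generated by the coordinates. *)
Definition dprod_display (n : nat) : ('I_n -> measure_display) -> measure_display.
Proof. by move=> _; exact: default_measure_display. Qed.

Definition dprod (n : nat) (d : 'I_n -> measure_display)
  (T : forall i, measurableType (d i)) : Type := forall i, T i.

Section dprod_measurable.
Variables (n : nat) (d : 'I_n -> measure_display).
Variable T : forall i, measurableType (d i).

HB.instance Definition _ := gen_eqMixin (dprod T).
HB.instance Definition _ := gen_choiceMixin (dprod T).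
HB.instance Definition _ := isPointed.Build (dprod T) (fun=> point).

Definition dprod_cylinders : set (set (dprod T)) :=
  \bigcup_i preimage_set_system setT (fun w : dprod T => w i) measurable.

Let dprod_set0 : <<s dprod_cylinders >> set0.
Proof. exact: sigma_algebra0. Qed.

Let dprod_setC A : <<s dprod_cylinders >> A -> <<s dprod_cylinders >> (~` A).
Proof. exact: sigma_algebraC. Qed.

Let dprod_bigcup (F : (set (dprod T))^nat) :
  (forall i, <<s dprod_cylinders >> (F i)) ->
  <<s dprod_cylinders >> (\bigcup_i (F i)).
Proof. exact: sigma_algebra_bigcup. Qed.

HB.instance Definition _ := @isMeasurable.Build (dprod_display d)
  (dprod T) <<s dprod_cylinders >> dprod_set0 dprod_setC dprod_bigcup.

Lemma measurable_dprod_proj i : measurable_fun setT (fun w : dprod T => w i).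
Proof.
by move=> _ A mA; apply: sub_sigma_algebra; exists i => //; exists A.
Qed.

Lemma measurable_fun_dprod d0 (S : measurableType d0) (f : S -> dprod T) :
  (forall i, measurable_fun setT (fun s => f s i)) -> measurable_fun setT f.
Proof.
move=> mf; apply: (measurability dprod_cylinders) => //.
move=> _ [_ [i _ [A mA <-]] <-].
by rewrite [X in measurable X](_ : _ = setT `&` (fun s => f s i) @^-1` A);
  [exact: mf|rewrite !setTI].
Qed.

End dprod_measurable.

Section dprod_cons.
Variables (n : nat) (d : 'I_n.+1 -> measure_display).
Variable T : forall i, measurableType (d i).

Definition dprod_cons
    (x : T ord0 * dprod (fun j : 'I_n => T (lift ord0 j))) : dprod T :=
  fun i => match unliftP ord0 i with
           | UnliftSome j e => ecast k (T k) (esym e) (x.2 j)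
           | UnliftNone e => ecast k (T k) (esym e) x.1
           end.

Lemma dprod_cons0 x : dprod_cons x ord0 = x.1.
Proof.
rewrite /dprod_cons; case: unliftP => [j e|e].
  by case/eqP: (neq_lift ord0 j).
by rewrite (eq_axiomK e).
Qed.

Lemma dprod_cons_lift x j : dprod_cons x (lift ord0 j) = x.2 j.
Proof.
rewrite /dprod_cons; case: unliftP => [k e|e].
  have jk := lift_inj e; subst k.
  by rewrite (eq_axiomK e).
by case/eqP: (neq_lift ord0 j); rewrite e.
Qed.

Lemma measurable_dprod_cons : measurable_fun setT dprod_cons.
Proof.
apply: measurable_fun_dprod => i; case: (unliftP ord0 i) => [/= j ->|->].
  rewrite (_ : dprod_cons^~ _ = fun x => x.2 j); last first.
    by apply/funext => x; exact: dprod_cons_lift.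
  have mj := @measurable_dprod_proj n _ (fun j => T (lift ord0 j)) j.
  exact: (measurableT_comp mj measurable_snd).
rewrite (_ : dprod_cons^~ _ = fst); last by apply/funext => x; exact: dprod_cons0.
exact: measurable_fst.
Qed.

HB.instance Definition _ := isMeasurableFun.Build _ _ _ _ dprod_cons
  measurable_dprod_cons.

End dprod_cons.

Section pair_prob.
Context d1 d2 (T1 : measurableType d1) (T2 : measurableType d2) (R : realType).
Variables (P1 : probability T1 R) (P2 : probability T2 R).

Definition pair_prob : set (T1 * T2) -> \bar R := (P1 \x P2)%E.

HB.instance Definition _ := Measure.on pair_prob.

Lemma pair_probE (A : set T1) (B : set T2) : measurable A -> measurable B ->
  pair_prob (A `*` B) = (P1 A * P2 B)%E.
Proof. by move=> mA mB; rewrite /pair_prob product_measure1E. Qed.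

Let pair_prob_setT : pair_prob setT = 1%E.
Proof.
rewrite -setXTT pair_probE//.
by rewrite (probability_setT P1) (probability_setT P2) mule1.
Qed.

HB.instance Definition _ :=
  Measure_isProbability.Build _ _ _ pair_prob pair_prob_setT.

End pair_prob.

(* The product probability; dprod_probE is its characteristic property. *)
Fixpoint dprod_prob (R : realType) (n : nat) :
    forall (d : 'I_n -> measure_display) (T : forall i, measurableType (d i)),
    (forall i, probability (T i) R) -> probability (dprod T) R :=
  match n with
  | 0 => fun d T P => \d_(point : dprod T)
  | n.+1 => fun d T P =>
      distribution (pair_prob (P ord0) (dprod_prob (fun j => P (lift ord0 j))))
                   (@dprod_cons n d T)
  end.

Lemma dprod_probE (R : realType) (n : nat) (d : 'I_n -> measure_display)
    (T : forall i, measurableType (d i)) (P : forall i, probability (T i) R)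
    (A : forall i, set (T i)) : (forall i, measurable (A i)) ->
  dprod_prob P [set w | forall i, A i (w i)] = (\prod_(i < n) P i (A i))%E.
Proof.
elim: n d T P A => [|n IH] d T P A mA /=.
  by rewrite big_ord0 diracE mem_set//= => -[].
rewrite big_ord_recl /= -IH//.
rewrite /distribution/= /pushforward.
rewrite [X in pair_prob _ _ X](_ : _ =
    A ord0 `*` [set w | forall j, A (lift ord0 j) (w j)]).
  rewrite pair_probE//.
  rewrite [X in measurable X](_ : _ = \bigcap_(j in setT)
      ((fun w : dprod (fun j : 'I_n => T (lift ord0 j)) => w j)
       @^-1` A (lift ord0 j))).
    apply: fin_bigcap_measurable => // j _.
    by rewrite -[X in measurable X]setTI; exact: measurable_dprod_proj.
  by apply/seteqP; split => [w /= h j _|w /= h j];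
    [exact: h|exact: (h j I)].
apply/seteqP; split => [x /= h|x /= [h0 h] i].
  split; first by rewrite -(dprod_cons0 x).
  by move=> j; rewrite -(dprod_cons_lift x).
by case: (unliftP ord0 i) => [j ->|->]; rewrite ?dprod_cons_lift ?dprod_cons0.
Qed.

(* The alphabet of the discrete scheme, with n.+1 letters: an empty alphabet
   carries no probability distribution. *)
Section discrete_outcomes.
Variable n : nat.

Definition outcome : Type := 'I_n.+1.

HB.instance Definition _ := Choice.on outcome.
HB.instance Definition _ := isPointed.Build outcome ord0.
HB.instance Definition _ := @isMeasurable.Build default_measure_display
  outcome discrete_measurable discrete_measurable0
  discrete_measurableC discrete_measurableU.

End discrete_outcomes.

Definition open_simplex (R : realType) (n : nat) : set 'cV[R]_n :=
  [set mu | (forall i, 0 < mu i 0) /\ \sum_i mu i 0 = 1].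

Section discrete_prob.
Variables (R : realType) (n : nat) (mu : 'cV[R]_n.+1).

(* As with the library's named distributions, a parameter outside the meaningful
   range gives a default (Dirac) probability. *)
Definition discrete_prob (A : set (outcome n)) : \bar R :=
  if `[< open_simplex mu >]
  then (\sum_(i < n.+1 | (i : outcome n) \in A) mu i 0)%:E
  else \d_(point : outcome n) A.

Let discrete_prob0 : discrete_prob set0 = 0%E.
Proof.
rewrite /discrete_prob; case: ifPn => _; last by rewrite measure0.
by rewrite big_pred0// => i; rewrite in_set0.
Qed.

Let discrete_prob_ge0 A : (0 <= discrete_prob A)%E.
Proof.
rewrite /discrete_prob; case: asboolP => [[mu0 _]|_ //].
by rewrite lee_fin sumr_ge0// => i _; rewrite ltW.
Qed.

Let discrete_prob_sigma_additive : semi_sigma_additive discrete_prob.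
Proof.
rewrite /discrete_prob; case: asboolP => [[mu0 _]|_]; last first.
  exact: measure_semi_sigma_additive.
have mu0' i : 0 <= mu i 0 by rewrite ltW.
pose m i : {measure set (outcome n) -> \bar R} :=
  mscale (NngNum (mu0' i)) (\d_(i : outcome n)).
have mE A : (\sum_(i < n.+1 | (i : outcome n) \in A) mu i 0)%:E =
            msum (fun k => m (inord k)) n.+1 A.
  rewrite /msum -sumEFin big_mkcond/=; apply: eq_bigr => i _.
  rewrite inord_val /m /mscale/= diracE; case: ifPn => _.
    by rewrite mule1.
  by rewrite mule0.
move=> F mF tF mUF; rewrite mE; under eq_fun do under eq_bigr do rewrite mE.
exact: measure_semi_sigma_additive.
Qed.

HB.instance Definition _ := isMeasure.Build _ _ _ discrete_prob
  discrete_prob0 discrete_prob_ge0 discrete_prob_sigma_additive.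

Let discrete_prob_setT : discrete_prob setT = 1%E.
Proof.
rewrite /discrete_prob; case: asboolP => [[_ mu1]|_]; last first.
  exact: probability_setT.
by rewrite -mu1; congr EFin; apply: eq_bigl => i; rewrite in_setT.
Qed.

HB.instance Definition _ :=
  @Measure_isProbability.Build _ _ R discrete_prob discrete_prob_setT.

End discrete_prob.

Section covariance.
Variables (R : realType).

Definition nondeg_covariance (m : nat) (Sigma : 'M[R]_m) : Prop :=
  [/\ Sigma^T = Sigma,
      forall v : 'cV[R]_m, 0 <= (v^T *m Sigma *m v) 0 0 &
      Sigma \in unitmx].

Lemma psd_factor (m : nat) (S : 'M[R]_m) :
  S^T = S -> (forall v : 'cV[R]_m, 0 <= (v^T *m S *m v) 0 0) ->
  exists A : 'M[R]_m, A *m A^T = S.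
Proof.
elim: m S => [S _ _|m IH S]; first by exists 0; apply/matrixP => -[].
rewrite -[m.+1]/(1 + m)%N in S *; rewrite -[S]submxK.
move: (ulsubmx S) (ursubmx S) (dlsubmx S) (drsubmx S) => a bT b C {S}.
rewrite tr_block_mx => /eq_block_mx[_ bTE _ CE] psd.
have {}bTE : bT = b^T by rewrite -bTE.
subst bT; pose a0 := a 0 0.
have aE : a = a0%:M by rewrite [a]mx11_scalar.
have q (t : R) (w : 'cV[R]_m) :
    0 <= t ^+ 2 * a0 + 2 * t * (b^T *m w) 0 0 + (w^T *m C *m w) 0 0.
  have := psd (col_mx t%:M w).
  rewrite tr_col_mx mul_row_block mul_row_col mulmxDl mulmxDl aE.
  have -> : w^T *m b = ((b^T *m w) 0 0)%:M.
    by rewrite [LHS]mx11_scalar -[w^T *m b]trmxK trmx_mul trmxK mxE.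
  rewrite tr_scalar_mx -!mulmxA !mul_scalar_mx [b^T *m w]mx11_scalar.
  rewrite !mxE /= !mulr1n.
  set X := \sum_j _; set Y := \sum_j _ => h; rewrite (le_trans h)//.
  by rewrite le_eqVlt; apply/orP; left; apply/eqP; ring.
have a_ge0 : 0 <= a0 by have := q 1 0; rewrite !mulmx0 !mxE; lra.
have b0 : a0 = 0 -> b = 0.
  move=> az; apply/matrixP => i j; rewrite [j]ord1 mxE.
  pose w : 'cV[R]_m := b.
  have [|bb] := eqVneq ((b^T *m b) 0 0) 0.
    rewrite mxE => /eqP; rewrite psumr_eq0 => [/allP/(_ i)|k _]; last first.
      by rewrite mxE -expr2 sqr_ge0.
    by rewrite mem_index_enum mxE -expr2 sqrf_eq0 => /(_ isT)/eqP.
  have := q (- (1 + (b^T *m C *m b) 0 0) / (2 * (b^T *m b) 0 0)) b.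
  rewrite az mulr0 add0r.
  rewrite (_ : 2 * _ * _ = - (1 + (b^T *m C *m b) 0 0)); first lra.
  by field.
pose S' := C - a0^-1 *: (b *m b^T).
have [] := IH S'.
- by rewrite /S' linearB/= linearZ/= trmx_mul trmxK CE.
- move=> w; have -> : (w^T *m S' *m w) 0 0 =
      (w^T *m C *m w) 0 0 - a0^-1 * (b^T *m w) 0 0 ^+ 2.
    rewrite /S' mulmxBr mulmxBl -scalemxAr -scalemxAl (mulmxA w^T b).
    rewrite (_ : w^T *m b = ((b^T *m w) 0 0)%:M).
      rewrite mul_scalar_mx -scalemxAl [LHS]mxE [X in _ + X]mxE [X in _ - X]mxE.
      by rewrite [X in _ - _ * X]mxE expr2.
    by rewrite [LHS]mx11_scalar -[w^T *m b]trmxK trmx_mul trmxK mxE.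
  have [az|an0] := eqVneq a0 0.
    rewrite az invr0 mul0r subr0; have := q 0 w.
    lra.
  have := q (- (b^T *m w) 0 0 / a0) w.
  set x := (b^T *m w) 0 0; set y := (w^T *m C *m w) 0 0 => h.
  rewrite (le_trans h)// le_eqVlt; apply/orP; left; apply/eqP.
  by field.
move=> A AE.
exists (block_mx (Num.sqrt a0)%:M 0 ((Num.sqrt a0)^-1 *: b) A).
rewrite tr_block_mx mulmx_block !trmx0 !mul0mx !mulmx0 !addr0 tr_scalar_mx.
rewrite -scalar_mxM -expr2 sqr_sqrtr// -aE !mul_scalar_mx !mul_mx_scalar.
rewrite linearZ/= scalerA AE /S' -scalemxAl -scalemxAr [in LHS]scalerA.
rewrite scalerA -invfM -expr2 sqr_sqrtr// addrC subrK.
have [az|an0] := eqVneq a0 0; first by rewrite b0// trmx0 !scaler0.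
by rewrite mulfV ?mulVf ?scale1r// sqrtr_eq0 -ltNge lt_neqAle eq_sym an0.
Qed.

End covariance.

Section gaussian.
Variables (R : realType) (m : nat).

(* N(mu, Sigma) is defined as the law of mu + A z, where A A^T = Sigma and z has
   independent N(0, 1) entries; this law does not depend on the choice of A. *)
Definition cov_factor (Sigma : 'M[R]_m) : 'M[R]_m :=
  [get A : 'M[R]_m | A *m A^T = Sigma].

Lemma cov_factorP (Sigma : 'M[R]_m) : nondeg_covariance Sigma ->
  cov_factor Sigma *m (cov_factor Sigma)^T = Sigma.
Proof. by move=> [symS psdS _]; exact: (getPex (psd_factor symS psdS)). Qed.

(* R^m as an observation space. *)
Definition rvec := dprod (fun _ : 'I_m => measurableTypeR R).

HB.instance Definition _ := Measurable.on rvec.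

Definition col_of_rvec (w : rvec) : 'cV[R]_m := \col_i w i.

Definition std_gaussian : probability rvec R :=
  dprod_prob (fun _ : 'I_m => normal_prob (0 : R) 1).

Definition affine_rvec (mu : 'cV[R]_m) (A : 'M[R]_m) (z : rvec) : rvec :=
  fun i => (mu + A *m col_of_rvec z) i 0.

Lemma measurable_affine_rvec mu A : measurable_fun setT (affine_rvec mu A).
Proof.
apply: measurable_fun_dprod => i.
rewrite (_ : (fun z => _) = (fun z : rvec => mu i 0 + \sum_j A i j * z j)).
  apply: (@measurable_realfun.measurable_funD _ rvec R setT) => //.
  apply: measurable_sum => j.
  apply: measurable_realfun.measurable_funM => //.
  exact: (@measurable_dprod_proj _ _ (fun _ : 'I_m => measurableTypeR R) j).
apply/funext => z; rewrite /affine_rvec !mxE; congr (_ + _).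
by apply: eq_bigr => j _; rewrite mxE.
Qed.

HB.instance Definition _ mu A := isMeasurableFun.Build _ _ _ _
  (affine_rvec mu A) (measurable_affine_rvec mu A).

Definition gaussian_prob (mu : 'cV[R]_m) (Sigma : 'M[R]_m) :
    probability rvec R :=
  distribution std_gaussian (affine_rvec mu (cov_factor Sigma)).

End gaussian.

Inductive scheme (R : realType) : Type :=
| Gaussian (m : nat) (Sigma : 'M[R]_m) of nondeg_covariance Sigma
| Poisson
| Discrete (n : nat).
Arguments Poisson {R}.
Arguments Discrete {R} n.

Section scheme.
Variable R : realType.

Definition obs_display (s : scheme R) : measure_display :=
  match s with
  | Gaussian m _ _ => dprod_display (fun _ : 'I_m => (R.-ocitv.-measurable).-sigma)%mdisp
  | Poisson | Discrete _ => default_measure_display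
  end.

Definition obs (s : scheme R) : measurableType (obs_display s) :=
  match s with
  | Gaussian m _ _ => rvec R m
  | Poisson => nat
  | Discrete n => outcome n
  end.

(* Parameters of all the schemes are column vectors; that of the Poisson scheme
   is its only entry. *)
Definition param_dim (s : scheme R) : nat :=
  match s with
  | Gaussian m _ _ => m
  | Poisson => 1
  | Discrete n => n.+1
  end.

Definition param_set (s : scheme R) : set 'cV[R]_(param_dim s) :=
  match s with
  | Gaussian m _ _ => [set: 'cV[R]_m]
  | Poisson => [set mu : 'cV[R]_1 | 0 < mu 0 0]
  | Discrete n => @open_simplex R n.+1
  end.

(* Meaningful for parameters in param_set s. The last argument of poisson_prob
   is not used in its definition. *)
Definition obs_law (s : scheme R) :
    'cV[R]_(param_dim s) -> probability (obs s) R :=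
  match s with
  | Gaussian m Sigma _ => fun mu => gaussian_prob mu Sigma
  | Poisson => fun mu : 'cV[R]_1 => poisson_prob (mu 0 0) 0
  | Discrete n => fun mu => discrete_prob mu
  end.

Definition psi (s : scheme R) : forall mu nu : 'cV[R]_(param_dim s), R :=
  match s with
  | Gaussian m Sigma _ => fun mu nu : 'cV[R]_m =>
      - 4^-1 * ((mu - nu)^T *m invmx Sigma *m (mu - nu)) 0 0
  | Poisson => fun mu nu : 'cV[R]_1 =>
      - (Num.sqrt (mu 0 0) - Num.sqrt (nu 0 0)) ^+ 2
  | Discrete n => fun mu nu : 'cV[R]_n.+1 =>
      2 * ln (\sum_i Num.sqrt (mu i 0 * nu i 0))
  end.

Definition factor_detector (s : scheme R) :
    forall x y : 'cV[R]_(param_dim s), obs s -> R :=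
  match s with
  | Gaussian m Sigma _ => fun (x y : 'cV[R]_m) (w : rvec R m) =>
      let xi := 2^-1 *: (invmx Sigma *m (x - y)) in
      let alpha := 2^-1 * (xi^T *m (x + y)) 0 0 in
      (xi^T *m col_of_rvec w) 0 0 - alpha
  | Poisson => fun (x y : 'cV[R]_1) (w : nat) =>
      2^-1 * w%:R * ln (x 0 0 / y 0 0) - 2^-1 * (x 0 0 - y 0 0)
  | Discrete n => fun (x y : 'cV[R]_n.+1) (w : outcome n) =>
      2^-1 * ln (x (w : 'I_n.+1) 0 / y (w : 'I_n.+1) 0)
  end.

End scheme.

Section product_scheme.
Variables (R : realType) (K : nat) (O : 'I_K -> scheme R).

Definition obsK := dprod (fun k => obs (O k)).
HB.instance Definition _ := Measurable.on obsK.

Definition paramK : Type := forall k, 'cV[R]_(param_dim (O k)).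

Definition obs_lawK (mu : paramK) : probability obsK R :=
  dprod_prob (fun k => obs_law (mu k)).

Definition boxK (X : forall k, set 'cV[R]_(param_dim (O k))) : set paramK :=
  [set mu | forall k, X k (mu k)].

Definition psiK (x y : paramK) : R := \sum_(k < K) psi (x k) (y k).

Definition optimal_solution (X Y : set paramK) (xy : paramK * paramK) : Prop :=
  [/\ X xy.1, Y xy.2 &
      forall x y, X x -> Y y -> psiK x y <= psiK xy.1 xy.2].

Definition opt_value (X Y : set paramK) : R :=
  sup [set psiK xy.1 xy.2 | xy in X `*` Y].

Definition detectorK (x y : paramK) (w : obsK) : R :=
  \sum_(k < K) factor_detector (x k) (y k) (w k).

(* A test maps an observation to true when it accepts the hypothesis H_X
   (and rejects H_Y), and to false otherwise. *)
Definition is_test (T : obsK -> bool) : Prop := measurable_fun setT T.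

Definition simple_test (phi : obsK -> R) (w : obsK) : bool := 0 <= phi w.

Definition err_X (X : set paramK) (T : obsK -> bool) : \bar R :=
  ereal_sup [set obs_lawK mu [set w | ~~ T w] | mu in X].

Definition err_Y (Y : set paramK) (T : obsK -> bool) : \bar R :=
  ereal_sup [set obs_lawK mu [set w | T w] | mu in Y].

Definition risk (X Y : set paramK) (T : obsK -> bool) : \bar R :=
  Order.max (err_X X T) (err_Y Y T).

End product_scheme.

(* Main.v *)
Require Import Defs.
From HB Require Import structures.
From mathcomp Require Import all_boot all_order all_algebra.
From mathcomp Require Import all_classical all_reals all_analysis.
From mathcomp Require Import measurable_realfun ring lra.
Import Order.TTheory GRing.Theory Num.Theory.
Import numFieldNormedType.Exports.

(** Write [phi] for the sum of the factor detectors built from the optimal pair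
    [(x, y)], and [P_u] for the law of the observation with parameter [u].

    In each of the three families [- 2 phi] is the log-likelihood ratio of [P_y]
    against [P_x] ([obs_law_density]), so [exp (- phi)] is the geometric mean
    of the densities of [P_x] and [P_y] relative to [P_x]. Its integral under
    [P_x] is the Hellinger affinity of the two laws, which is
    [exp (psi (x, y) / 2)] ([detector_mgf_diag]).

    Risk of the simple test. By Markov's inequality for [exp (a - phi)]
    ([chernoff]), the probability under [P_u] that [phi < a] is at most [exp a]
    times the integral of [exp (- phi)] under [P_u]. The families are
    exponential, hence this integral has a closed form, [detector_mgf], factor
    by factor: in each factor, [exp (- phi)] is a constant times the likelihood
    ratio of [P_v] against [P_u] for some third parameter [v] ([half_tilt]), and
    likelihood ratios integrate to 1. That closed form, or its logarithm, is
    affine in [u], and its slope at [x] is a positive multiple of the gradient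
    of [psi (., y)] or of [exp (psi (., y) / 2)]. Since [X] is a box, each [x k]
    maximizes its own term over the convex set [X k], so moving from [x k] to
    any other point of [X k] cannot increase the integral ([detector_mgf_le]).
    Exchanging [x] and [y] changes the sign of [phi] and gives the other error.

    Lower bound. Only the two laws [P_x] and [P_y] matter. If a test rejects the
    first hypothesis on [A], the Cauchy-Schwarz inequality on [A] and on its
    complement gives
    [eps <= sqrt (P_x A) + sqrt (P_y (~ A)) <= 2 sqrt (risk)], which is
    [affinity_le_max_error]; there, Cauchy-Schwarz takes the form of the
    arithmetic-geometric mean inequality with an optimized weight.

    All integrals are handled through the relation [change_of_measure], which
    is stable under finite products by Tonelli's theorem
    ([change_of_measure_dprod]). *)

Local Open Scope classical_set_scope.
Local Open Scope ring_scope.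

Set Implicit Arguments.
Unset Strict Implicit.
Unset Printing Implicit Defensive.

(** * Changes of measure on products *)

Section change_of_measure.
Context d1 d2 (S : measurableType d1) (T : measurableType d2) (R : realType).

(** For [tau = id] this says that [Q] has density [f] with respect to [P]; in
    general it says so of the image of [Q] under [tau]. The map [tau] is there
    for the shift formula of Gaussian laws; stating the relation on integrals of
    nonnegative functions lets it pass through Tonelli's theorem. *)
Definition change_of_measure (Q : {measure set S -> \bar R}) (tau : S -> T)
    (P : {measure set T -> \bar R}) (f : T -> R) : Prop :=
  forall g : T -> \bar R, measurable_fun setT g -> (forall t, 0 <= g t)%E ->
    (\int[Q]_s g (tau s) = \int[P]_t (g t * (f t)%:E))%E.

End change_of_measure.

Section density.
Context d (T : measurableType d) (R : realType).
Local Open Scope ereal_scope.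
Import HBNNSimple.

(** Both sides are continuous along an increasing approximation of [g] by
    simple functions, and for the indicator of a set the claim is the
    hypothesis. *)
Lemma density_change_of_measure (Q M : {measure set T -> \bar R}) (f : T -> R) :
  measurable_fun setT f -> (forall t, 0 <= f t)%R ->
  (forall A, measurable A -> Q A = \int[M]_(t in A) (f t)%:E) ->
  change_of_measure Q id M f.
Proof.
move=> mf f0 QE g mg g0 /=.
have mfE : measurable_fun setT (EFin \o f) by exact/measurable_EFinP.
pose h := nnsfun_approx measurableT mg.
have hlim t : limn (fun n => (h n t)%:E) = g t.
  by apply/cvg_lim => //; apply: cvg_nnsfun_approx => // x _; exact: g0.
have hnd t : {homo (fun n => (h n t)) : m n / (m <= n)%N >-> (m <= n)%R}.
  by move=> m n mn; exact/lefP/nd_nnsfun_approx.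
have suf n : \int[Q]_t (h n t)%:E = \int[M]_t ((h n t)%:E * (f t)%:E).
  under eq_integral do rewrite fimfunE -fsumEFin//.
  under [RHS]eq_integral => t _.
    rewrite fimfunE -fsumEFin// ge0_mule_fsuml; last first.
      by move=> r; exact: nnfun_muleindic_ge0.
    over.
  rewrite ge0_integral_fsum//; last 2 first.
    - by move=> r; apply/measurable_EFinP; exact: measurable_funM.
    - by move=> r t _; exact: nnfun_muleindic_ge0.
  rewrite ge0_integral_fsum//; last 2 first.
    - move=> r; apply: emeasurable_funM => //.
      by apply/measurable_EFinP; exact: measurable_funM.
    - by move=> r t _; rewrite mule_ge0 ?lee_fin// ; exact: nnfun_muleindic_ge0.
  apply: eq_fsbigr => r /[!inE] -[t0 _ rE].
  have r0 : (0 <= r)%R by rewrite -rE.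
  have mr : measurable (h n @^-1` [set r]) by [].
  under eq_integral do rewrite EFinM.
  rewrite ge0_integralZl//; last exact/measurable_EFinP.
  rewrite integral_indic// setIT QE//.
  under [RHS]eq_integral do rewrite EFinM -muleA.
  rewrite ge0_integralZl//; last 2 first.
    - by apply: emeasurable_funM => //; exact/measurable_EFinP.
    - by move=> t _; rewrite mule_ge0 ?lee_fin.
  congr (_ * _); rewrite integral_mkcond; apply: eq_integral => t _.
  rewrite /= restrict_EFin /= patchE indicE.
  by case: ifPn => _; rewrite ?mul1e ?mul0e.
under eq_integral do rewrite -hlim.
rewrite monotone_convergence//; last 3 first.
  - by move=> n; exact/measurable_EFinP.
  - by move=> n t _; rewrite lee_fin.
  - by move=> t _ m n mn; rewrite lee_fin hnd.
have E t : g t * (f t)%:E = limn (fun n => (h n t)%:E * (f t)%:E).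
  apply/esym/cvg_lim => //; apply: cvgeZr => //.
  by apply: cvg_nnsfun_approx => // x _; exact: g0.
under [RHS]eq_integral do rewrite E.
rewrite monotone_convergence//; last 3 first.
  - by move=> n; apply: emeasurable_funM => //; exact/measurable_EFinP.
  - by move=> n t _; rewrite mule_ge0 ?lee_fin.
  - by move=> t _ m n mn; rewrite lee_wpmul2r ?lee_fin// hnd.
by under eq_fun do rewrite suf.
Qed.

End density.

Section product.
Variable R : realType.
Local Open Scope ereal_scope.

Lemma ge0_integral_dprod_prob n (d : 'I_n.+1 -> measure_display)
    (T : forall i, measurableType (d i)) (P : forall i, probability (T i) R)
    (g : dprod T -> \bar R) : measurable_fun setT g -> (forall w, 0 <= g w) ->
  \int[dprod_prob P]_w g w =
  \int[P ord0]_x \int[dprod_prob (fun j => P (lift ord0 j))]_v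
    g (dprod_cons (x, v)).
Proof.
move=> mg g0 /=; rewrite ge0_integral_distribution//.
rewrite -(fubini_tonelli1 (fun x => g (dprod_cons x)))//.
by apply: measurableT_comp => //; exact: measurable_dprod_cons.
Qed.

Definition dprod_map n (d e : 'I_n -> measure_display)
    (S : forall i, measurableType (d i)) (T : forall i, measurableType (e i))
    (tau : forall i, S i -> T i) (w : dprod S) : dprod T :=
  fun i => tau i (w i).

Lemma measurable_dprod_map n (d e : 'I_n -> measure_display)
    (S : forall i, measurableType (d i)) (T : forall i, measurableType (e i))
    (tau : forall i, S i -> T i) :
  (forall i, measurable_fun setT (tau i)) ->
  measurable_fun setT (dprod_map tau).
Proof.
move=> mtau; apply: measurable_fun_dprod => i.
by apply: measurableT_comp => //; exact: measurable_dprod_proj.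
Qed.

(** Induction on the number of factors: by Tonelli's theorem the change of
    measure is done first in the tail, for a fixed first coordinate, then in the
    first coordinate. *)
Lemma change_of_measure_dprod n (d e : 'I_n -> measure_display)
    (S : forall i, measurableType (d i)) (T : forall i, measurableType (e i))
    (Q : forall i, probability (S i) R) (P : forall i, probability (T i) R)
    (tau : forall i, S i -> T i) (f : forall i, T i -> R) :
  (forall i, measurable_fun setT (tau i)) ->
  (forall i, measurable_fun setT (f i)) -> (forall i t, 0 <= f i t)%R ->
  (forall i, change_of_measure (Q i) (tau i) (P i) (f i)) ->
  change_of_measure (dprod_prob Q) (dprod_map tau)
    (dprod_prob P) (fun w : dprod T => \prod_(i < n) f i (w i))%R.
Proof.
elim: n d e S T Q P tau f => [|n IH] d e S T Q P tau f mtau mf f0 cm g mg g0.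
  rewrite /= !integral_dirac//=; last 2 first.
    - apply: emeasurable_funM => //; under eq_fun do rewrite big_ord0.
      exact: measurable_cst.
    - by apply: measurableT_comp => //; apply: measurable_fun_dprod => -[].
  rewrite !diracT !mul1e big_ord0 mule1; congr g.
  by apply/functional_extensionality_dep => -[].
have mtauw := measurable_dprod_map mtau.
have mfw : measurable_fun setT
    (fun w : dprod T => \prod_(i < n.+1) f i (w i))%R.
  apply: measurable_prod => i _.
  by apply: measurableT_comp => //; exact: measurable_dprod_proj.
rewrite ge0_integral_dprod_prob//; last exact: measurableT_comp.
rewrite [RHS]ge0_integral_dprod_prob//; last 2 first.
  - by apply: emeasurable_funM => //; exact/measurable_EFinP.
  - by move=> w; rewrite mule_ge0// lee_fin prodr_ge0.
pose Pl := dprod_prob (fun j => P (lift ord0 j)).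
pose fl (v : dprod (fun j => T (lift ord0 j))) :=
  (\prod_(j < n) f (lift ord0 j) (v j))%R.
have mfl : measurable_fun setT fl.
  apply: measurable_prod => i _; apply: measurableT_comp => //.
  exact: (@measurable_dprod_proj _ _ (fun j => T (lift ord0 j)) i).
have fl0 v : (0 <= fl v)%R by rewrite prodr_ge0.
have mgc : measurable_fun setT (g \o (@dprod_cons n e T)).
  by apply: measurableT_comp => //; exact: measurable_dprod_cons.
pose G x := \int[Pl]_v (g (dprod_cons (x, v)) * (fl v)%:E).
have mprod : measurable_fun setT
    (fun z => g (@dprod_cons n e T z) * (fl z.2)%:E).
  apply: emeasurable_funM => //; apply/measurable_EFinP.
  exact: (measurableT_comp mfl measurable_snd).
have G0 x : 0 <= G x.
  by apply: integral_ge0 => v _; rewrite mule_ge0 ?lee_fin.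
transitivity (\int[Q ord0]_x G (tau ord0 x)).
  apply: eq_integral => x _; rewrite /G /Pl.
  rewrite -(IH _ _ _ _ (fun j => Q (lift ord0 j)) (fun j => P (lift ord0 j))
     (fun j => tau (lift ord0 j)) (fun j => f (lift ord0 j)) _ _ _ _
     (fun v => g (dprod_cons (tau ord0 x, v))))//.
    apply: eq_integral => v _; congr g.
    apply/functional_extensionality_dep => i.
    by case: (unliftP ord0 i) => [j ->|->];
       rewrite /dprod_map ?dprod_cons_lift ?dprod_cons0.
  exact: (measurableT_comp mgc (pair1_measurable _)).
rewrite cm//; last first.
  apply: (measurable_fun_fubini_tonelli_F
    (fun z => g (@dprod_cons n e T z) * (fl z.2)%:E) mprod) => z.
  by rewrite mule_ge0 ?lee_fin.
apply: eq_integral => t _; rewrite /G -ge0_integralZr//; last 3 first.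
- exact: (measurableT_comp mprod (pair1_measurable t)).
- by move=> v _; rewrite mule_ge0 ?lee_fin.
- by rewrite lee_fin.
apply: eq_integral => v _; rewrite -muleA -EFinM big_ord_recl dprod_cons0 mulrC.
congr (_ * (_ * _)%:E); apply: eq_bigr => j _.
by rewrite dprod_cons_lift.
Qed.

End product.

(** * The laws of one factor *)

Section translations.
Variable R : realType.

Definition translation (h : R) (x : measurableTypeR R) : measurableTypeR R :=
  x + h.

Lemma measurable_translation h : measurable_fun setT (translation h).
Proof. exact: measurable_funD. Qed.

Lemma lebesgue_measure_translation (h : R) (A : set (measurableTypeR R)) :
  measurable A ->
  pushforward lebesgue_measure (translation h) A = lebesgue_measure A.
Proof.
pose H := isMeasurableFun.Build _ _ _ _ _ (measurable_translation h).
pose th : {mfun (measurableTypeR R) >-> (measurableTypeR R)} :=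
  HB.pack (translation h) H.
move=> mA; apply/esym.
apply: (@lebesgue_measure_unique _ (pushforward lebesgue_measure th)) => //=.
move=> _ [[a b]] _ <-.
rewrite /pushforward (_ : _ @^-1` _ = `]a - h, b - h]%classic); last first.
  by apply/seteqP; split => x /=; rewrite !in_itv/= ltrBlDr lerBrDr.
by rewrite !lebesgue_measure_itv/= !lte_fin ltrD2r -!EFinD opprB addrA subrK.
Qed.

(** The one-dimensional Cameron-Martin formula: by translation invariance of
    Lebesgue measure, the shifted normal law has density [p (x - h)], and
    [p (x - h) / p x = exp (h x - h^2 / 2)]. *)
Lemma normal_shift_density (h : R) :
  change_of_measure (normal_prob (0 : R) 1) (translation h)
    (normal_prob (0 : R) 1) (fun x => expR (h * x - h ^+ 2 / 2)).
Proof.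
have dens : change_of_measure (normal_prob (0 : R) 1) id lebesgue_measure
    (normal_pdf 0 1).
  apply: density_change_of_measure => //.
  - exact: measurable_normal_pdf.
  - exact: normal_pdf_ge0.
move=> g mg g0.
have mpdf : measurable_fun setT (EFin \o @normal_pdf R 0 1).
  by apply/measurable_EFinP; exact: measurable_normal_pdf.
have mexp : measurable_fun setT (fun x : R => expR (h * x - h ^+ 2 / 2)).
  by apply: measurableT_comp => //; apply: measurable_funB => //;
     exact: measurable_funM.
rewrite (dens (fun x => g (translation h x)))//; last first.
  exact: (measurableT_comp mg (measurable_translation h)).
rewrite (dens (fun x => g x * (expR (h * x - h ^+ 2 / 2))%:E)%E); last 2 first.
- by apply: emeasurable_funM => //; exact/measurable_EFinP.
- by move=> t; rewrite mule_ge0// lee_fin expR_ge0.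
transitivity (\int[pushforward lebesgue_measure (translation h)]_x
    (g x * (normal_pdf 0 1 (x - h))%:E))%E; last first.
  rewrite [LHS](eq_measure_integral lebesgue_measure); last first.
    by move=> mth A mA _; exact: lebesgue_measure_translation.
    exact: measurable_translation.
  apply: eq_integral => x _; rewrite -muleA -EFinM; congr (_ * _%:E)%E.
  rewrite !normal_pdfE ?oner_neq0//= /normal_fun mulrCA -expRD.
  congr (_ * expR _).
  by field.
rewrite ge0_integral_pushforward//=.
- by apply: eq_integral => x _; rewrite /translation addrK.
- exact: measurable_translation.
- apply: emeasurable_funM => //.
  by apply: (measurableT_comp mpdf); exact: (measurable_translation (- h)).
- by move=> x _; rewrite mule_ge0// lee_fin normal_pdf_ge0.
Qed.

(** The Cameron-Martin formula in dimension [m], as a product of the scalar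
    ones. *)
Lemma std_gaussian_shift_density m (h : 'cV[R]_m) :
  change_of_measure (@std_gaussian R m)
    (dprod_map (fun i => translation (h i 0)))
    (@std_gaussian R m)
    (fun z => expR ((h^T *m col_of_rvec z) 0 0 - (h^T *m h) 0 0 / 2)).
Proof.
have mexp c : measurable_fun setT
    (fun x : measurableTypeR R => expR (c * x - c ^+ 2 / 2)).
  by apply: measurableT_comp => //; apply: measurable_funB => //;
     exact: measurable_funM.
move=> g mg g0.
have /(_ g mg g0) -> := @change_of_measure_dprod R m _ _
  (fun=> measurableTypeR R) (fun=> measurableTypeR R)
  (fun=> normal_prob 0 1) (fun=> normal_prob 0 1)
  (fun i => translation (h i 0))
  (fun i x => expR (h i 0 * x - h i 0 ^+ 2 / 2))
  (fun i => measurable_translation (h i 0)) (fun i => mexp (h i 0))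
  (fun i t => expR_ge0 _) (fun i => normal_shift_density (h i 0)).
apply: eq_integral => z _; congr (_ * _%:E)%E.
rewrite -expR_sum; congr expR; rewrite big_split/= sumrN -mulr_suml !mxE.
by congr (_ - _ / 2); apply: eq_bigr => i _; rewrite !mxE.
Qed.

End translations.

Section laws.
Variable R : realType.

Lemma measurable_col_form m (c : 'cV[R]_m) :
  measurable_fun setT (fun w : rvec R m => (c^T *m col_of_rvec w) 0 0).
Proof.
rewrite (_ : (fun w => _) = (fun w : rvec R m => \sum_j c j 0 * w j)).
  apply: measurable_sum => j; apply: measurable_funM => //.
  exact: (@measurable_dprod_proj _ _ (fun _ : 'I_m => measurableTypeR R) j).
by apply/funext => w; rewrite mxE; apply: eq_bigr => j _; rewrite !mxE.
Qed.

Lemma measurable_factor_detector (s : scheme R)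
    (x y : 'cV[R]_(param_dim s)) : measurable_fun setT (factor_detector x y).
Proof.
case: s x y => [m Sigma S_ok||n] x y /=; last 2 first.
- by move=> _ B _.
- by move=> _ B _.
by apply: measurable_funB => //; exact: measurable_col_form.
Qed.

(** With [Sigma = A A^T], the map [z |-> y + A z] is [z |-> x + A (z + h)] for
    [h = A^-1 (y - x)]; so the change of mean is a translation of the standard
    Gaussian vector, whose density [exp (h^T z - h^T h / 2)] is then written in
    terms of [x + A z]. *)
Lemma gaussian_density m (Sigma : 'M[R]_m) (S_ok : nondeg_covariance Sigma)
    (x y : 'cV[R]_m) :
  change_of_measure (gaussian_prob y Sigma) id (gaussian_prob x Sigma)
    (fun w => expR (- 2 * @factor_detector R (Gaussian S_ok) x y w)).
Proof.
move=> g mg g0 /=.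
set A := cov_factor Sigma.
have AS : A *m A^T = Sigma by exact: cov_factorP.
have [_ _ Su] := S_ok.
have Au : A \in unitmx by move: Su; rewrite -AS unitmx_mul => /andP[].
pose h := invmx A *m (y - x).
have Ah : A *m h = y - x by rewrite mulKVmx.
rewrite ge0_integral_distribution// ge0_integral_distribution//; last 2 first.
- apply: emeasurable_funM => //; apply/measurable_EFinP.
  apply: measurableT_comp => //; apply: measurable_funM => //.
  exact: (measurable_factor_detector (s := Gaussian S_ok)).
- by move=> w; rewrite mule_ge0// lee_fin expR_ge0.
rewrite -/A /comp /=.
have -> : affine_rvec y A = (fun z =>
    affine_rvec x A (dprod_map (fun i => translation (h i 0)) z)).
  apply/funext => z; apply/functional_extensionality_dep => i.
  rewrite /affine_rvec -[y in LHS](subrK x) -Ah.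
  rewrite [A *m h + x]addrC -addrA -mulmxDr.
  congr ((_ + _ *m _) _ _).
  apply/matrixP => j k; rewrite [LHS]mxE [X in _ + X]mxE [RHS]mxE [k]ord1.
  by rewrite addrC.
rewrite (std_gaussian_shift_density h
  (g := fun z => g (affine_rvec x A z))); last 2 first.
- by apply: measurableT_comp => //; exact: measurable_affine_rvec.
- by move=> t; exact: g0.
apply: eq_integral => z _; congr (_ * (expR _)%:E)%E.
have -> : col_of_rvec (affine_rvec x A z) = x + A *m col_of_rvec z.
  by apply/matrixP => j k; rewrite [k]ord1 [LHS]mxE.
have -> : invmx Sigma *m (x - y) = - (invmx A^T *m h).
  rewrite /h -AS.
  have -> : invmx (A *m A^T) = invmx A^T *m invmx A.
    have ATu : A^T \in unitmx by rewrite unitmx_tr.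
    apply: (can_inj (mulKmx Su)); rewrite -AS mulmxV ?AS// -AS.
    by rewrite -mulmxA mulKVmx ?mulmxV.
  by rewrite -mulmxA -mulmxN -mulmxN opprB.
have q v : ((2^-1 *: - (invmx A^T *m h))^T *m v) 0 0 =
    - 2^-1 * (h^T *m (invmx A *m v)) 0 0.
  rewrite scalerN -scaleNr linearZ/= trmx_mul trmx_inv trmxK -scalemxAl mxE.
  by rewrite mulmxA.
rewrite !q mulmxDr mulKmx// mulmxDr.
have -> : invmx A *m (x + y) = invmx A *m x *+ 2 + h.
  rewrite /h mulmxBr mulmxDr mulr2n; move: (invmx A *m x) (invmx A *m y) => a b.
  by rewrite [RHS]addrC addrA subrK addrC.
rewrite mulmxDr mulr2n mulmxDr !mxE.
set a := \sum_j _ ; set b := \sum_j _; set c := \sum_j _.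
by field.
Qed.

(** The quotient of the two densities with respect to the counting measure. *)
Lemma poisson_density (x y : R) (k l : nat) : 0 < x -> 0 < y ->
  change_of_measure (poisson_prob y l) id (poisson_prob x k)
    (fun w => (y / x) ^+ w * expR (x - y)).
Proof.
move=> x0 y0.
have dens (r : R) j : 0 < r ->
    change_of_measure (poisson_prob r j) id (@counting nat R) (poisson_pmf r).
  move=> r0; apply: density_change_of_measure => //.
    by move=> t; exact: poisson_pmf_ge0.
  move=> A _.
  have fA0 i : (0 <= ((fun t => (poisson_pmf r t)%:E) \_ A) i)%E.
    by apply: erestrict_ge0 => t _; rewrite lee_fin poisson_pmf_ge0.
  rewrite integral_mkcond ge0_integral_count// nneseries_esumT//.
  transitivity (\esum_(i in A) (poisson_pmf r i)%:E)%E.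
    by rewrite /= /poisson_prob r0.
  by rewrite (esum_mkcond A); apply: eq_esum => i _; rewrite patchE.
move=> g mg g0; rewrite (dens y)// (dens x)//; last first.
  move=> t; rewrite mule_ge0// lee_fin mulr_ge0 ?expR_ge0// exprn_ge0//.
  by rewrite divr_ge0 ?ltW.
apply: eq_integral => w _; rewrite -muleA -EFinM; congr (_ * _%:E)%E.
rewrite /poisson_pmf x0 y0 expRD expr_div_n.
have -> : expR (- x) = (expR x)^-1 by rewrite expRN.
have := expR_gt0 x; have : x ^+ w != 0 by rewrite expf_neq0// gt_eqF.
have : w`!%:R != 0 :> R by rewrite pnatr_eq0 -lt0n fact_gt0.
move=> ? ? /lt0r_neq0 ?; field.
by apply/and3P.
Qed.

Lemma discrete_density n (x y : 'cV[R]_n.+1) :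
  open_simplex x -> open_simplex y ->
  change_of_measure (discrete_prob y) id (discrete_prob x)
    (fun w : outcome n => y (w : 'I_n.+1) 0 / x (w : 'I_n.+1) 0).
Proof.
move=> sx sy.
have intE (u : 'cV[R]_n.+1) (g : outcome n -> \bar R) : open_simplex u ->
    (forall i, 0 <= g i)%E ->
    (\int[discrete_prob u]_w g w = \sum_(i < n.+1) (u i 0)%:E * g i)%E.
  move=> su g0.
  have u0 i : 0 <= u i 0 by rewrite ltW//; case: su.
  pose m i : {measure set (outcome n) -> \bar R} :=
    mscale (NngNum (u0 i)) (\d_(i : outcome n)).
  rewrite (eq_measure_integral (msum (fun k => m (inord k)) n.+1)); last first.
    move=> A mA _; rewrite /= /discrete_prob asboolT// /msum -sumEFin.
    rewrite big_mkcond/=; apply: eq_bigr => i _.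
    rewrite inord_val /m /mscale/= diracE.
    by case: ifPn => _; rewrite ?mule1 ?mule0.
  rewrite ge0_integral_measure_sum//.
  apply: eq_bigr => i _; rewrite inord_val ge0_integral_mscale//.
  by rewrite integral_dirac// diracT mul1e.
move=> g _ g0.
have [[x0 _] [y0 _]] := (sx, sy).
rewrite !intE// => [|i]; last by rewrite mule_ge0// lee_fin divr_ge0// ltW.
apply: eq_bigr => i _; rewrite muleCA -EFinM mulrC muleC; congr (_ * _%:E)%E.
by rewrite divfK// gt_eqF.
Qed.

(** Twice the detector is the log-likelihood ratio. *)
Lemma obs_law_density (s : scheme R) (x y : 'cV[R]_(param_dim s)) :
  param_set x -> param_set y ->
  change_of_measure (obs_law y) id (obs_law x)
    (fun w => expR (- 2 * factor_detector x y w)).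
Proof.
case: s x y => [m Sigma S_ok||n] x y px py.
- exact: gaussian_density.
- rewrite (_ : (fun w => _) =
      (fun w => (y 0 0 / x 0 0) ^+ w * expR (x 0 0 - y 0 0))).
    exact: poisson_density.
  apply/funext => w /=.
  have yx0 : 0 < y 0 0 / x 0 0 by rewrite divr_gt0.
  rewrite -[in RHS](lnK yx0) -expRM_natl -expRD -[x 0 0 / _]invf_div lnV//.
  by congr expR; field.
- rewrite (_ : (fun w => _) =
      (fun w : outcome n => y (w : 'I_n.+1) 0 / x (w : 'I_n.+1) 0)).
    exact: discrete_density.
  apply/funext => w /=; have [[x0 _] [y0 _]] := (px, py).
  have yx0 : 0 < y w 0 / x w 0 by rewrite divr_gt0.
  rewrite -[RHS](lnK yx0) -[x w 0 / _]invf_div lnV//.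
  by congr expR; field.
Qed.
End laws.

(** * First-order optimality without derivatives *)

Section first_order.
Variable R : realType.

(** A replacement for differentiation at 0: if the affine part [t L] of an
    increment never exceeds a quadratic remainder, then [L <= 0]. *)
Lemma le0_of_quadratic (L C : R) :
  (forall t, 0 < t -> t <= 1 -> t * L <= t ^+ 2 * C) -> L <= 0.
Proof.
move=> LC; rewrite leNgt; apply/negP => L0.
(* t := L / (L + |C| + 1) is at most 1 and satisfies t C < L *)
have D0 : 0 < L + `|C| + 1 by rewrite -addrA ltr_wpDr// addr_ge0.
have t0 : 0 < L / (L + `|C| + 1) by rewrite divr_gt0.
have t1 : L / (L + `|C| + 1) <= 1.
  by rewrite ler_pdivrMr// mul1r -addrA lerDl addr_ge0.
have := LC _ t0 t1; rewrite expr2 -mulrA ler_pM2l// leNgt => /negP; apply.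
rewrite mulrAC ltr_pdivrMr// ltr_pM2l// (le_lt_trans (ler_norm _))//.
by rewrite addrAC ltrDr addr_gt0.
Qed.

(** The second-order lower bound of the square root at [x], valid on the whole
    domain. When the bound is positive, comparing squares reduces it to
    [h^2 (3 - h) (h + 1) >= 0], and positivity forces [h < 2]. *)
Lemma sqrt_ge_quadratic (x h : R) : 0 <= x -> - 1 <= h ->
  Num.sqrt x * (1 + h / 2 - h ^+ 2 / 2) <= Num.sqrt (x * (1 + h)).
Proof.
move=> x0 h1; rewrite sqrtrM// ler_wpM2l ?sqrtr_ge0//.
have [q0|q0] := leP (1 + h / 2 - h ^+ 2 / 2) 0.
  by rewrite (le_trans q0) ?sqrtr_ge0.
rewrite -[leLHS]ger0_norm ?(ltW q0)// -sqrtr_sqr ler_wsqrtr//.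
have h3 : h <= 3 by nra.
rewrite -subr_ge0 (_ : _ - _ = h ^+ 2 / 4 * ((3 - h) * (h + 1))); last by field.
by rewrite mulr_ge0 ?divr_ge0 ?sqr_ge0// mulr_ge0; lra.
Qed.

Lemma convex_set_segment n (A : set 'cV[R]_n) (x u : 'cV[R]_n) (t : R) :
  convex_set A -> A x -> A u -> 0 <= t -> t <= 1 -> A (x + t *: (u - x)).
Proof.
move=> cA Ax Au t0 t1.
suff -> : x + t *: (u - x) = t *: u + (1 - t) *: x.
  exact/set_mem/(cA u x (Itv01 t0 t1) (mem_set Au) (mem_set Ax)).
by rewrite scalerBr scalerBl scale1r addrCA.
Qed.
End first_order.

(** * Exponential moments of the detector of one factor *)

Section detector.
Variable R : realType.


Section qform.
Variables (m : nat) (S : 'M[R]_m).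
Implicit Types a b c : 'cV[R]_m.

Definition qform a b : R := (a^T *m S *m b) 0 0.

Lemma qformDl a b c : qform (a + b) c = qform a c + qform b c.
Proof. by rewrite /qform linearD/= !mulmxDl mxE. Qed.

Lemma qformDr a b c : qform a (b + c) = qform a b + qform a c.
Proof. by rewrite /qform mulmxDr mxE. Qed.

Lemma qformZl (k : R) a b : qform (k *: a) b = k * qform a b.
Proof. by rewrite /qform linearZ/= -!scalemxAl mxE. Qed.

Lemma qformZr (k : R) a b : qform a (k *: b) = k * qform a b.
Proof. by rewrite /qform -scalemxAr mxE. Qed.

Lemma qformNl a b : qform (- a) b = - qform a b.
Proof. by rewrite -scaleN1r qformZl mulN1r. Qed.

Lemma qformNr a b : qform a (- b) = - qform a b.
Proof. by rewrite -scaleN1r qformZr mulN1r. Qed.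

Definition qformE := (qformDl, qformDr, qformNl, qformNr, qformZl, qformZr).

Lemma qformC a b : S^T = S -> qform a b = qform b a.
Proof.
move=> sS; rewrite /qform -[in RHS](trmxK (b^T *m S *m a)) [RHS]mxE.
by rewrite !trmx_mul trmxK sS mulmxA.
Qed.

End qform.

Lemma invmx_sym m (Sigma : 'M[R]_m) : nondeg_covariance Sigma ->
  (invmx Sigma)^T = invmx Sigma.
Proof. by case=> sS _ _; rewrite trmx_inv sS. Qed.

(** The detector is centred at the midpoint of the two means. *)
Lemma gaussian_detectorE m (Sigma : 'M[R]_m) (S_ok : nondeg_covariance Sigma)
    (x y : 'cV[R]_m) (w : rvec R m) :
  @factor_detector R (Gaussian S_ok) x y w =
  2^-1 * qform (invmx Sigma) (x - y) (col_of_rvec w - 2^-1 *: (x + y)).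
Proof.
rewrite /= qformDr qformNr qformZr mulrBr /qform.
have -> : (2^-1 *: (invmx Sigma *m (x - y)))^T =
    2^-1 *: ((x - y)^T *m invmx Sigma).
  by rewrite linearZ/= trmx_mul invmx_sym.
by rewrite -!scalemxAl [in LHS]mxE [X in _ - _ * X]mxE.
Qed.

Lemma psi_sym (s : scheme R) (x y : 'cV[R]_(param_dim s)) : psi x y = psi y x.
Proof.
case: s x y => [m Sigma S_ok||n] x y /=.
- rewrite -/(qform _ _ _) -/(qform _ (y - x) _) !qformE.
  by ring.
- by rewrite -sqrrN opprB.
- by congr (2 * ln _); apply: eq_bigr => i _; rewrite mulrC.
Qed.

Lemma factor_detectorC (s : scheme R) (x y : 'cV[R]_(param_dim s)) w :
  param_set x -> param_set y -> factor_detector y x w = - factor_detector x y w.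
Proof.
case: s x y w => [m Sigma S_ok||n] x y w px py.
- have sym (a b : 'cV[R]_m) := qformC a b (invmx_sym S_ok).
  rewrite !gaussian_detectorE !qformE (sym y x).
  by field.
- rewrite /= -[y 0 0 / _]invf_div lnV ?posrE ?divr_gt0//.
  by field.
- have [[x0 _] [y0 _]] := (px, py).
  by rewrite /= -[y w 0 / _]invf_div lnV ?posrE ?divr_gt0// mulrN.
Qed.

(** The integral of [exp (- factor_detector x y)] under the law with parameter
    [u]; see [half_tilt]. *)
Definition detector_mgf (s : scheme R) :
    forall x y u : 'cV[R]_(param_dim s), R :=
  match s with
  | Gaussian m Sigma _ => fun x y u : 'cV[R]_m =>
      expR (- 2^-1 * qform (invmx Sigma) (x - y) (u - 2^-1 *: (x + y))
            + 8^-1 * qform (invmx Sigma) (x - y) (x - y))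
  | Poisson => fun x y u : 'cV[R]_1 =>
      expR (u 0 0 * (Num.sqrt (y 0 0 / x 0 0) - 1) + 2^-1 * (x 0 0 - y 0 0))
  | Discrete n => fun x y u : 'cV[R]_n.+1 =>
      \sum_i u i 0 * Num.sqrt (y i 0 / x i 0)
  end.

Lemma detector_mgf_ge0 (s : scheme R) (a b c : 'cV[R]_(param_dim s)) :
  param_set c -> 0 <= detector_mgf a b c.
Proof.
case: s a b c => [m Sigma S_ok||n] a b c pc; rewrite /= ?expR_ge0//.
have [c0 _] := pc.
by apply: sumr_ge0 => i _; rewrite mulr_ge0 ?sqrtr_ge0// ltW.
Qed.

(** Tilting the law of [u] by the square root of the likelihood ratio of [y]
    against [x] stays within the family: [v] is [u] moved by half of [y - x] in
    the Gaussian case, and [u] multiplied by [sqrt (y / x)], entrywise and then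
    normalized, in the other two. The normalizing constant is
    [detector_mgf x y u]. *)
Lemma half_tilt (s : scheme R) (x y u : 'cV[R]_(param_dim s)) :
  param_set x -> param_set y -> param_set u ->
  exists2 v, param_set v & forall w,
    expR (- factor_detector x y w) =
    detector_mgf x y u * expR (- 2 * factor_detector u v w).
Proof.
case: s x y u => [m Sigma S_ok||n] x y u px py pu.
- exists (u - 2^-1 *: (x - y)) => // w.
  rewrite !gaussian_detectorE /detector_mgf.
  rewrite -expRD; congr expR.
  have sym (a b : 'cV[R]_m) := qformC a b (invmx_sym S_ok).
  rewrite !qformE (sym y x) (sym x u) (sym y u).
  by field.
- have [x0 y0 u0] : [/\ 0 < x 0 0, 0 < y 0 0 & 0 < u 0 0] by [].
  have yx0 : 0 < y 0 0 / x 0 0 by rewrite divr_gt0.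
  have r0 : 0 < Num.sqrt (y 0 0 / x 0 0) by rewrite sqrtr_gt0.
  exists (Num.sqrt (y 0 0 / x 0 0) *: u : 'cV[R]_1) => [/=|w /=].
    by rewrite mxE mulr_gt0.
  rewrite -expRD; congr expR.
  rewrite mxE -[u 0 0 / _]invf_div mulfK ?gt_eqF// lnV ?posrE//.
  rewrite -[x 0 0 / _]invf_div lnV ?posrE// -[in LHS](sqr_sqrtr (ltW yx0)).
  by rewrite lnXn// mulr2n; field.
- have [[x0 x1] [y0 y1] [u0 u1]] := And3 px py pu.
  have r0 i : 0 < Num.sqrt (y i 0 / x i 0) by rewrite sqrtr_gt0 divr_gt0.
  have C0 : 0 < \sum_i u i 0 * Num.sqrt (y i 0 / x i 0).
    rewrite big_ord_recl ltr_pwDl ?mulr_gt0// sumr_ge0// => i _.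
    by rewrite mulr_ge0// ltW.
  set C := \sum_i _ in C0 *.
  exists (\col_i (u i 0 * Num.sqrt (y i 0 / x i 0) / C)) => [/=|w /=].
    split=> [i|]; first by rewrite mxE divr_gt0// mulr_gt0.
    rewrite (eq_bigr (fun i => u i 0 * Num.sqrt (y i 0 / x i 0) / C)).
      by rewrite -mulr_suml divff// gt_eqF.
    by move=> i _; rewrite mxE.
  have yx0 : 0 < y w 0 / x w 0 by rewrite divr_gt0.
  rewrite mxE (_ : _ / (_ / C) = C / Num.sqrt (y w 0 / x w 0)); last first.
    by field; rewrite !gt_eqF.
  rewrite -[x w 0 / _]invf_div lnV ?posrE// -[in LHS](sqr_sqrtr (ltW yx0)).
  rewrite lnXn// mulr2n ln_div ?posrE//.
  rewrite -[X in X * expR _](lnK (C0 : C \in Num.pos)).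
  by rewrite -expRD; congr expR; field.
Qed.

(** The Hellinger affinity of the laws with parameters [x] and [y]. *)
Lemma detector_mgf_diag (s : scheme R) (x y : 'cV[R]_(param_dim s)) :
  param_set x -> param_set y -> detector_mgf x y x = expR (psi x y / 2).
Proof.
case: s x y => [m Sigma S_ok||n] x y px py.
- rewrite /=; congr expR.
  by rewrite -/(qform _ _ _) !qformE; field.
- have [x0 y0] : 0 < x 0 0 /\ 0 < y 0 0 by [].
  rewrite /=; congr expR; rewrite sqrtrM ?ltW// sqrtrV ?ltW//.
  have := sqr_sqrtr (ltW x0); have := sqr_sqrtr (ltW y0).
  have : Num.sqrt (x 0 0) != 0 by rewrite sqrtr_eq0 -ltNge.
  move: (Num.sqrt (x 0 0)) (Num.sqrt (y 0 0)) => r q r0 <- <-.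
  by field.
- have [[x0 x1] [y0 y1]] := (px, py).
  rewrite /= mulrAC divff ?mul1r ?pnatr_eq0// lnK; last first.
    rewrite posrE big_ord_recl ltr_pwDl ?sqrtr_gt0 ?mulr_gt0//.
    by rewrite sumr_ge0// => i _; rewrite sqrtr_ge0.
  apply: eq_bigr => i _; rewrite !sqrtrM ?ltW// sqrtrV ?ltW//.
  have := sqr_sqrtr (ltW (x0 i)).
  have : Num.sqrt (x i 0) != 0 by rewrite sqrtr_eq0 -ltNge.
  move: (Num.sqrt (x i 0)) => r r0 <-.
  by field.
Qed.

(** The inequality is the first-order optimality condition of [x] in the
    direction [u - x]. Along the segment from [x] to [u], [psi (., y)] (in the
    discrete case, [exp (psi (., y) / 2)]) increases by at least an affine term
    minus a quadratic one, and the affine term has the sign of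
    [detector_mgf x y u - detector_mgf x y x]. *)
Lemma detector_mgf_le (s : scheme R) (X : set 'cV[R]_(param_dim s))
    (x y u : 'cV[R]_(param_dim s)) :
  X `<=` param_set (s := s) -> convex_set X -> X x -> X u -> param_set y ->
  (forall z, X z -> psi z y <= psi x y) ->
  detector_mgf x y u <= detector_mgf x y x.
Proof.
move=> Xsub cX Xx Xu py opt.
have seg t : 0 < t -> t <= 1 -> X (x + t *: (u - x)).
  by move=> t0 t1; apply: convex_set_segment => //; exact: ltW.
have px := Xsub _ Xx; have pu := Xsub _ Xu.
case: s X x y u Xsub cX Xx Xu py opt seg px pu => [m Sigma S_ok||n] X x y u
  Xsub cX Xx Xu py opt seg px pu.
- have sym (a b : 'cV[R]_m) := qformC a b (invmx_sym S_ok).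
  rewrite /detector_mgf ler_expR lerD2r -subr_le0.
  (* e and d are kept opaque, so that the forms are expanded in them only *)
  have [e eE] : exists e : 'cV[R]_m, e = x - y by exists (x - y).
  have [d dE] : exists d : 'cV[R]_m, d = u - x by exists (u - x).
  have L : - qform (invmx Sigma) e d <= 0.
    apply: (le0_of_quadratic (C := qform (invmx Sigma) d d / 2)) => t t0 t1.
    have := opt _ (seg t t0 t1).
    rewrite /= -/(qform _ _ _) -/(qform _ (x - y) _) addrAC -dE -eE.
    by rewrite !qformE (sym d e); nra.
  rewrite -mulrBr -!qformNr -qformDr opprB addrA subrK -dE -eE.
  by rewrite mulNr -mulrN; lra.
- have [x0 y0 u0] : [/\ 0 < x 0 0, 0 < y 0 0 & 0 < u 0 0] by [].
  rewrite /= ler_expR lerD2r -subr_le0 -mulrBl.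
  set r := Num.sqrt (y 0 0 / x 0 0).
  have aE : Num.sqrt (x 0 0 * y 0 0) = x 0 0 * r.
    rewrite /r !sqrtrM ?ltW// sqrtrV ?ltW//.
    have := sqr_sqrtr (ltW x0); have : Num.sqrt (x 0 0) != 0.
      by rewrite sqrtr_eq0 -ltNge.
    by move: (Num.sqrt (x 0 0)) => c c0 <-; field.
  set h := (u 0 0 - x 0 0) / x 0 0.
  apply: (le0_of_quadratic (C := x 0 0 * r * h ^+ 2)) => t t0 t1.
  have := opt _ (seg t t0 t1).
  have psiE (z : 'cV[R]_1) : 0 <= z 0 0 -> psi (s := Poisson) z y =
      - z 0 0 - y 0 0 + 2 * Num.sqrt (z 0 0 * y 0 0).
    move=> z0; rewrite /= sqrtrM// -{2}(sqr_sqrtr z0) -{2}(sqr_sqrtr (ltW y0)).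
    by ring.
  have zE : (x + t *: (u - x)) 0 0 = x 0 0 * (1 + t * h).
    by rewrite !mxE /h; field; rewrite gt_eqF.
  have zt0 : 0 < (x + t *: (u - x)) 0 0 by exact: (Xsub _ (seg t t0 t1)).
  rewrite !psiE ?(ltW x0) ?(ltW zt0)// zE mulrAC aE.
  have th : - 1 <= t * h.
    by move: zt0; rewrite zE pmulr_rgt0//; lra.
  have := sqrt_ge_quadratic (ltW (mulr_gt0 x0 y0)) th.
  rewrite aE (_ : u 0 0 - x 0 0 = x 0 0 * h); last first.
    by rewrite /h mulrCA divff ?mulr1// gt_eqF.
  by nra.
- have [[x0 _] [y0 _]] := (px, py).
  pose a i := Num.sqrt (x i 0 * y i 0); pose h i := (u i 0 - x i 0) / x i 0.
  have L : \sum_i a i * h i <= 0.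
    apply: (le0_of_quadratic (C := \sum_i a i * h i ^+ 2)) => t t0 t1.
    have [z0 _] := Xsub _ (seg t t0 t1).
    have S0 (z : 'cV[R]_n.+1) : (forall i, 0 < z i 0) ->
        0 < \sum_i Num.sqrt (z i 0 * y i 0).
      move=> z_gt0; rewrite big_ord_recl ltr_pwDl ?sqrtr_gt0 ?mulr_gt0//.
      by rewrite sumr_ge0// => i _; rewrite sqrtr_ge0.
    have := opt _ (seg t t0 t1); rewrite /= ler_pM2l// ler_ln ?posrE ?S0//.
    move=> le_sum.
    have : \sum_i a i * (1 + t * h i / 2 - (t * h i) ^+ 2 / 2) <= \sum_i a i.
      apply: le_trans le_sum; apply: ler_sum => i _.
      have zE : (x + t *: (u - x)) i 0 = x i 0 * (1 + t * h i).
        by rewrite !mxE /h; field; rewrite gt_eqF.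
      rewrite zE (mulrAC (x i 0)); apply: sqrt_ge_quadratic.
        by rewrite ltW ?mulr_gt0.
      by have := z0 i; rewrite zE pmulr_rgt0//; lra.
    have -> : \sum_i a i * (1 + t * h i / 2 - (t * h i) ^+ 2 / 2) =
        \sum_i a i + (t / 2) * (\sum_i a i * h i)
        - (t ^+ 2 / 2) * (\sum_i a i * h i ^+ 2).
      rewrite !mulr_sumr -big_split -sumrB/=.
      by apply: eq_bigr => i _; field.
    by lra.
  rewrite /= -subr_le0 -sumrB; apply: le_trans L.
  rewrite le_eqVlt; apply/orP; left; apply/eqP; apply: eq_bigr => i _.
  rewrite /a /h !sqrtrM ?ltW// sqrtrV ?ltW//.
  have := sqr_sqrtr (ltW (x0 i)).
  have : Num.sqrt (x i 0) != 0 by rewrite sqrtr_eq0 -ltNge.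
  move: (Num.sqrt (x i 0)) => r r0 <-.
  by field.
Qed.

End detector.

(** * Error bounds for two laws *)

Section two_point.
Context d (T : measurableType d) (R : realType).
Local Open Scope ereal_scope.

Lemma integral_affine_indic (P : probability T R) (A : set T) (c b : R) :
  measurable A -> (0 <= c)%R -> (0 <= b)%R ->
  \int[P]_t (c * \1_A t + b)%:E = c%:E * P A + b%:E.
Proof.
move=> mA c0 b0; under eq_integral do rewrite EFinD EFinM.
have mind : measurable_fun setT (fun t => (\1_A t : R)%:E).
  by apply/measurable_EFinP; exact: measurable_indic.
rewrite ge0_integralD//; last 2 first.
- by move=> t _; rewrite mule_ge0 ?lee_fin.
- exact: measurable_funeM.
rewrite ge0_integralZl//.
rewrite integral_indic// setIT integral_cst//.
congr (_ + _); rewrite -[RHS]mule1; congr (_ * _).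
exact: probability_setT.
Qed.

(** Integrate [2 exp (- phi) <= c + exp (- 2 phi) / c] on [A] and the same
    inequality with [1 / c] in place of [c] on the complement of [A]. Under [P]
    and [Q] respectively, the constants and the multiples of [exp (- 2 phi)]
    add up to [2 e <= c (P A + Q (~ A)) + 2 / c]. *)
Lemma affinity_le_max_error (P Q : probability T R) (phi : T -> R) (e : R)
    (A : set T) :
  measurable_fun setT phi ->
  change_of_measure Q id P (fun t => expR (- 2 * phi t)) ->
  (0 < e)%R -> \int[P]_t (expR (- phi t))%:E = e%:E -> measurable A ->
  (e ^+ 2 / 4)%:E <= Order.max (P A) (Q (~` A)).
Proof.
move=> mphi dens e0 inte mA.
have mAC : measurable (~` A) by exact: measurableC.
have mexp k : measurable_fun setT (fun t => (expR (k * phi t))%:E).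
  apply/measurable_EFinP; apply: measurableT_comp => //.
  exact: measurable_funM.
have mg (B : set T) (b c : R) : measurable B ->
    measurable_fun setT (fun t => (c * \1_B t + b)%:E).
  move=> mB; apply/measurable_EFinP; apply: measurable_funD => //.
  by apply: measurable_funM => //; exact: measurable_indic.
(* this weight turns the final bound into e^2 <= 2 (P A + Q (~ A)) *)
have [c cE] : exists c, c = (2 / e)%R by exists (2 / e)%R.
have c0 : (0 < c)%R by rewrite cE divr_gt0.
have cV0 : (0 < c^-1)%R by rewrite invr_gt0.
have g0 (B : set T) t : 0 <= (c * \1_B t + c^-1)%:E.
  by rewrite lee_fin addr_ge0 ?(ltW cV0)// mulr_ge0// ltW.
have : \int[P]_t (expR (- phi t))%:E + \int[P]_t (expR (- phi t))%:E <=
    \int[P]_t (c * \1_A t + c^-1)%:E + \int[Q]_t (c * \1_(~` A) t + c^-1)%:E.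
  rewrite dens//; last exact: mg.
  have mE : measurable_fun setT (fun t => (expR (- phi t))%:E).
    by under eq_fun do rewrite -mulN1r; exact: mexp.
  rewrite -!ge0_integralD//; last 2 first.
  - by move=> t _; rewrite mule_ge0// lee_fin expR_ge0.
  - by apply: emeasurable_funM; [exact: mg|exact: mexp].
  apply: ge0_le_integral => //.
  - by move=> t _; rewrite adde_ge0// lee_fin expR_ge0.
  - exact: emeasurable_funD.
  - by apply: emeasurable_funD; [exact: mg|];
       apply: emeasurable_funM; [exact: mg|exact: mexp].
  move=> t _; rewrite -EFinM -!EFinD lee_fin.
  rewrite mulNr mulr_natl mulr2n opprD expRD.
  move: (expR_gt0 (- phi t)); set x := expR _ => x0.
  have cn0 : c != 0%R by rewrite gt_eqF.
  rewrite !indicE in_setC; case: (t \in A) => /=.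
    have : (0 <= c^-1 * (c - x) ^+ 2)%R by rewrite mulr_ge0 ?sqr_ge0// ltW.
    rewrite (_ : _ * _ = c - x - x + c^-1 * (x * x))%R; last by field.
    by lra.
  have : (0 <= c^-1 * (1 - c * x) ^+ 2)%R by rewrite mulr_ge0 ?sqr_ge0// ltW.
  have : (0 <= c^-1 * (x * x))%R by rewrite !mulr_ge0// ltW.
  rewrite (_ : _ * (1 - _) ^+ 2 = c^-1 - x - x + c * (x * x))%R; last by field.
  by lra.
  exact: mg.
rewrite inte !integral_affine_indic ?(ltW c0) ?(ltW cV0)//.
rewrite -[P A]fineK ?fin_num_measure// -[Q _]fineK ?fin_num_measure//.
rewrite -EFin_max -!EFinM -!EFinD !lee_fin.
move: (fine _) (fine _) => q p; rewrite cE invf_div.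
move=> h; have : (e ^+ 2 <= 2 * (p + q))%R.
  have : (e * (e + e) <= e * (2 / e * p + e / 2 + (2 / e * q + e / 2)))%R.
    by rewrite ler_wpM2l// ltW.
  rewrite (_ : e * (_ + _ + (_ + _)) = 2 * (p + q) + e ^+ 2)%R; first by nra.
  by field; rewrite gt_eqF.
by rewrite le_max; have [pq|pq] := leP p q => ?; apply/orP; [right|left]; lra.
Qed.

(** Markov's inequality for [exp (a - phi)]. *)
Lemma chernoff (P : probability T R) (phi : T -> R) (a : R) (B : set T) :
  measurable_fun setT phi -> measurable B -> (forall t, B t -> phi t <= a)%R ->
  P B <= (expR a)%:E * \int[P]_t (expR (- phi t))%:E.
Proof.
move=> mphi mB Ba.
have mexp : measurable_fun setT (fun t => (expR (- phi t))%:E).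
  apply/measurable_EFinP; apply: measurableT_comp => //.
  exact: measurableT_comp.
rewrite -ge0_integralZl//.
rewrite -[B in P B]setIT -integral_indic//.
apply: ge0_le_integral => //.
- by apply/measurable_EFinP; exact: measurable_indic.
- exact: measurable_funeM.
move=> t _; rewrite -EFinM lee_fin -expRD indicE.
case: (boolP (t \in B)) => [/set_mem Bt|_]; last exact: expR_ge0.
by rewrite -[leLHS]expR0 ler_expR subr_ge0 Ba.
Qed.

End two_point.

(** * The product scheme *)

Section product_scheme.
Variables (R : realType) (K : nat) (O : 'I_K -> scheme R).
Implicit Types x y u : paramK O.

Local Notation paramsK x := (forall k, param_set (x k)).

Lemma measurable_detectorK x y : measurable_fun setT (detectorK x y).
Proof.
apply: measurable_sum => k.
have mk := measurable_factor_detector (x k) (y k).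
exact: (measurableT_comp mk
  (@measurable_dprod_proj _ _ (fun k => obs (O k)) k)).
Qed.

Lemma detectorKC x y w : paramsK x -> paramsK y ->
  detectorK y x w = - detectorK x y w.
Proof.
move=> px py; rewrite /detectorK -sumrN; apply: eq_bigr => k _.
exact: factor_detectorC.
Qed.

Lemma psiK_sym x y : psiK x y = psiK y x.
Proof. by apply: eq_bigr => k _; exact: psi_sym. Qed.

Lemma obs_lawK_density x y : paramsK x -> paramsK y ->
  change_of_measure (obs_lawK y) id (obs_lawK x)
    (fun w => expR (- 2 * detectorK x y w)).
Proof.
move=> px py g mg g0.
have mf k : measurable_fun setT
    (fun w => expR (- 2 * factor_detector (x k) (y k) w)).
  apply: measurableT_comp => //; apply: measurable_funM => //.
  exact: measurable_factor_detector.
have /(_ g mg g0) := change_of_measure_dprod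
  (fun k => @measurable_id _ _ setT) mf (fun k t => expR_ge0 _)
  (fun k => obs_law_density (px k) (py k)).
rewrite /dprod_map => ->; apply: eq_integral => w _.
by rewrite -expR_sum mulr_sumr.
Qed.

(** The factorwise tilts assemble into one product law with density proportional
    to [exp (- detectorK x y)]; so the integral is its normalizing constant. *)
Lemma obs_lawK_mgf x y u : paramsK x -> paramsK y -> paramsK u ->
  (\int[obs_lawK u]_w (expR (- detectorK x y w))%:E =
   (\prod_k detector_mgf (x k) (y k) (u k))%:E)%E.
Proof.
move=> px py pu.
pose tilt k := cid2 (half_tilt (px k) (py k) (pu k)).
pose v : paramK O := fun k => s2val (tilt k).
have pv k : param_set (v k) := s2valP (tilt k).
have vE k w := s2valP' (tilt k) w.
pose C := \prod_k detector_mgf (x k) (y k) (u k).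
have E w : expR (- detectorK x y w) = C * expR (- 2 * detectorK u v w).
  rewrite /detectorK -sumrN expR_sum mulr_sumr expR_sum -big_split/=.
  by apply: eq_bigr => k _; rewrite vE.
have C0 : 0 <= C by apply: prodr_ge0 => k _; exact: detector_mgf_ge0.
under eq_integral do rewrite E EFinM.
rewrite ge0_integralZl//; last first.
  apply/measurable_EFinP; apply: measurableT_comp => //.
  by apply: measurable_funM => //; exact: measurable_detectorK.
rewrite -[RHS]mule1; congr (_ * _)%E.
transitivity
  (\int[obs_lawK u]_w (cst 1 w * (expR (- 2 * detectorK u v w))%:E))%E.
  by apply: eq_integral => w _; rewrite mul1e.
rewrite -(obs_lawK_density pu pv (g := cst 1%E))// integral_cst// mul1e.
exact: probability_setT.
Qed.

(** As the domain is a box, one coordinate of the optimal solution can be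
    replaced while the others are kept. *)
Lemma psi_opt_factor (X Y : forall k, set 'cV[R]_(param_dim (O k))) x y
    k (z : 'cV[R]_(param_dim (O k))) :
  optimal_solution (boxK X) (boxK Y) (x, y) -> X k z ->
  psi z (y k) <= psi (x k) (y k).
Proof.
move=> [/= Xx Yy opt] Xz.
have Xz' : boxK X (dfwith x k z).
  move=> j; have [<-|jk] := eqVneq k j; first by rewrite dfwithin.
  by rewrite dfwithout// Xx.
have := opt _ _ Xz' Yy.
rewrite /psiK (bigD1 k)//= [leRHS](bigD1 k)//= dfwithin.
rewrite (eq_bigr (fun j => psi (x j) (y j))) ?lerD2r// => j jk.
by rewrite dfwithout// eq_sym.
Qed.

Lemma opt_valueE (X Y : set (paramK O)) x y :
  optimal_solution X Y (x, y) -> opt_value X Y = psiK x y.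
Proof.
move=> [/= Xx Yy opt]; apply/eqP; rewrite eq_le; apply/andP; split.
  apply: ge_sup; first by exists (psiK x y), (x, y).
  by move=> _ [[a b] [/= Xa Yb] <-]; exact: opt.
apply: ub_le_sup; last by exists (x, y).
by exists (psiK x y) => _ [[a b] [/= Xa Yb] <-]; exact: opt.
Qed.

Lemma optimal_solution_sym (X Y : set (paramK O)) x y :
  optimal_solution X Y (x, y) -> optimal_solution Y X (y, x).
Proof.
move=> [/= Xx Yy opt]; split=> //= a b Ya Xb.
by rewrite psiK_sym [leRHS]psiK_sym opt.
Qed.

Lemma obs_lawK_mgf_le (X Y : forall k, set 'cV[R]_(param_dim (O k))) x y u :
  (forall k, X k `<=` param_set (s := O k)) ->
  (forall k, Y k `<=` param_set (s := O k)) ->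
  (forall k, convex_set (X k)) ->
  optimal_solution (boxK X) (boxK Y) (x, y) -> boxK X u ->
  (\int[obs_lawK u]_w (expR (- detectorK x y w))%:E <=
   (expR (psiK x y / 2))%:E)%E.
Proof.
move=> Xs Ys cX opt Xu; have [/= Xx Yy _] := opt.
have px k := Xs k _ (Xx k); have py k := Ys k _ (Yy k).
have pu k := Xs k _ (Xu k).
rewrite obs_lawK_mgf// lee_fin /psiK mulr_suml expR_sum; apply: ler_prod => k _.
rewrite -detector_mgf_diag//; apply/andP; split.
  exact: detector_mgf_ge0.
apply: (detector_mgf_le (Xs k)) => // z; exact: (psi_opt_factor opt).
Qed.

End product_scheme.

Theorem proposition2p2 (R : realType) (K : nat) (O : 'I_K -> scheme R)
    (X Y : forall k, set 'cV[R]_(param_dim (O k)))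
    (X_sub : forall k, X k `<=` param_set (s := O k))
    (Y_sub : forall k, Y k `<=` param_set (s := O k))
    (X_nonempty : forall k, X k !=set0)
    (Y_nonempty : forall k, Y k !=set0)
    (X_compact : forall k, compact (X k))
    (Y_compact : forall k, compact (Y k))
    (X_convex : forall k, convex_set (X k))
    (Y_convex : forall k, convex_set (Y k))
    (xs ys : paramK O)
    (xs_ys_opt : optimal_solution (boxK X) (boxK Y) (xs, ys)) :
  let eps := expR (opt_value (boxK X) (boxK Y) / 2) in
  (forall a : R,
     let T := simple_test (fun w : obsK O => detectorK xs ys w - a) in
     (err_X (boxK X) T <= (expR a * eps)%:E)%E /\
     (err_Y (boxK Y) T <= (expR (- a) * eps)%:E)%E) /\
  (forall T : obsK O -> bool, is_test T ->
     ((eps ^+ 2 / 4)%:E <= risk (boxK X) (boxK Y) T)%E).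
Proof.
move=> eps; rewrite /eps (opt_valueE xs_ys_opt) {eps}.
have [/= Xxs Yys _] := xs_ys_opt.
have px k := X_sub k _ (Xxs k); have py k := Y_sub k _ (Yys k).
split=> [a|T mT].
  set T := simple_test _.
  have mT : measurable [set w | T w].
    rewrite (_ : [set w | T w] =
        setT `&` (fun w => detectorK xs ys w - a) @^-1` `[0, +oo[).
      apply: measurable_funB => //; exact: measurable_detectorK.
    apply/seteqP; split => w /=; rewrite in_itv/= andbT /T /simple_test.
      by split.
    by case.
  split; apply: ge_ereal_sup => _ [mu mu_in <-].
  - apply: (le_trans (chernoff (obs_lawK mu) (a := a)
      (measurable_detectorK xs ys) _ _)).
    + rewrite (_ : [set w | ~~ T w] = ~` [set w | T w]).
        exact: measurableC.
      by apply/seteqP; split => w /= /negP.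
    + by move=> w /=; rewrite /T /simple_test -ltNge subr_lt0 => /ltW.
    rewrite EFinM lee_wpmul2l ?lee_fin ?expR_ge0//.
    exact: (obs_lawK_mgf_le X_sub Y_sub).
  - apply: (le_trans (chernoff (obs_lawK mu) (a := - a)
      (measurable_detectorK ys xs) mT _)).
      move=> w /=; rewrite detectorKC// /T /simple_test subr_ge0.
      by rewrite lerN2.
    rewrite EFinM lee_wpmul2l ?lee_fin ?expR_ge0// psiK_sym.
    exact: (obs_lawK_mgf_le Y_sub X_sub Y_convex
      (optimal_solution_sym xs_ys_opt)).
have mA : measurable [set w | ~~ T w].
  rewrite (_ : [set w | ~~ T w] = setT `&` T @^-1` [set false]).
    exact: mT.
  by apply/seteqP; split => w /=; [move/negbTE => ->|case=> _ ->].
have mgfE : (\int[obs_lawK xs]_w (expR (- detectorK xs ys w))%:E =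
    (expR (psiK xs ys / 2))%:E)%E.
  rewrite obs_lawK_mgf//; congr EFin; rewrite /psiK mulr_suml expR_sum.
  by apply: eq_bigr => k _; exact: detector_mgf_diag.
apply: (le_trans (affinity_le_max_error (measurable_detectorK xs ys)
  (obs_lawK_density px py) (expR_gt0 _) mgfE mA)).
rewrite /risk /err_X /err_Y; apply: le_max2.
- by apply: ereal_sup_ubound; exists xs.
- apply: ereal_sup_ubound; exists ys => //.
  congr (obs_lawK ys _); apply/seteqP; split => w /=; first by move=> ->.
  by move/negP; rewrite negbK.
Qed.
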